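(* Let $B$ be a length-$n$, width-$w$ ordered branching program with at most $k$ non-regular layers. Then for all $k'\in[n]$, $$L^{k'}(B)=\sum_{s\in\{0,1\}^n:|s|=k'}\big\|\widehat B[s]\big\|_2\le\sqrt w\cdot\big((2w^2+1)\sqrt w\,(k+1)\big)^{k'}\le\sqrt w\cdot\big(3w^{2.5}(k+1)\big)^{k'}.$$
   Context: A length-$n$, width-$w$ ordered branching program (OBP) $B=B_1\circ\cdots\circ B_n$ has layers of vertices $V_0,\dots,V_n$ with $|V_i|\le w$, and layer $B_i$ is a map $V_{i-1}\times\{0,1\}\to V_i$. For $x\in\{0,1\}^n$, $B[x]$ is the $|V_0|\times|V_n|$ matrix with $B[x](u,v)=1$ if following the edges labelled $x_1,\dots,x_n$ from $u$ ends at $v$ and $0$ otherwise; thus $B[x]=B_1[x_1]\cdots B_n[x_n]$. Layer $i$ is regular if $|V_{i-1}|=|V_i|$ and the matrix $\mathbb{E}_U[B_i[U]]$ ($U$ uniform bit) is doubly stochastic, and non-regular otherwise. The Fourier transform is $\widehat B[s]=\mathbb{E}_U[B[U]\chi_s(U)]$ with $\chi_s(x)=(-1)^{\sum_{i\in s}x_i}$, $U$ uniform on $\{0,1\}^n$, and $\|\cdot\|_2$ is the operator norm induced by the Euclidean norm. *)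

(* Defs.v *)
From HB Require Import structures.
From mathcomp Require Import all_boot all_order all_algebra.
From mathcomp Require Import classical_sets reals exp.

Set Implicit Arguments.
Unset Strict Implicit.
Unset Printing Implicit Defensive.

Import Order.TTheory GRing.Theory Num.Theory.
Local Open Scope ring_scope.

(* The vertices of layer V_i are numbered, V_i = 'I_(obp_size B i), and
   obp_step B i is the layer B_(i+1) : V_i x {0,1} -> V_(i+1). Only
   V_0, ..., V_n and the steps i < n are ever used; the data at larger indices
   are a dummy continuation, which every program of length n admits (take
   identity maps on V_n). *)
Record obp (n w : nat) := OBP {
  obp_size : nat -> nat;
  obp_size_le : forall i, (i <= n)%N -> (obp_size i <= w)%N;
  obp_step : forall i, 'I_(obp_size i) -> bool -> 'I_(obp_size i.+1)
}.

Fixpoint obp_run n w (B : obp n w) (x : seq bool) (u : 'I_(obp_size B 0))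
    (i : nat) : 'I_(obp_size B i) :=
  match i with
  | 0 => u
  | j.+1 => @obp_step n w B j (obp_run x u j) (nth false x j)
  end.

Section Matrices.
Variable R : realType.

Definition obp_mx n w (B : obp n w) (x : n.-tuple bool)
    : 'M[R]_(obp_size B 0, obp_size B n) :=
  \matrix_(u, v) (obp_run x u n == v)%:R.

Definition layer_mx n w (B : obp n w) (i : nat) (b : bool)
    : 'M[R]_(obp_size B i, obp_size B i.+1) :=
  \matrix_(u, v) (@obp_step n w B i u b == v)%:R.

Definition layer_avg n w (B : obp n w) (i : nat)
    : 'M[R]_(obp_size B i, obp_size B i.+1) :=
  2^-1 *: \sum_(b : bool) layer_mx B i b.

(* Stated for an 'M_(p, q) because the two dimensions of a layer matrix are
   not convertible; regular_layer adds the requirement p = q. *)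
Definition doubly_stochastic p q (M : 'M[R]_(p, q)) : bool :=
  [&& [forall i, forall j, 0 <= M i j],
      [forall i, \sum_j M i j == 1] &
      [forall j, \sum_i M i j == 1]].

Definition regular_layer n w (B : obp n w) (i : nat) : bool :=
  (obp_size B i == obp_size B i.+1) && doubly_stochastic (layer_avg B i).

Definition nonregular_layers n w (B : obp n w) : {set 'I_n} :=
  [set i : 'I_n | ~~ regular_layer B i].

Definition chi n (s x : n.-tuple bool) : R :=
  (-1) ^+ (\sum_(i < n | tnth s i) tnth x i)%N.

Definition obp_fourier n w (B : obp n w) (s : n.-tuple bool)
    : 'M[R]_(obp_size B 0, obp_size B n) :=
  (2 ^+ n)^-1 *: \sum_(x : n.-tuple bool) chi s x *: obp_mx B x.

Definition norm2 p (v : 'cV[R]_p) : R := Num.sqrt (\sum_i v i 0 ^+ 2).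

(* The set is nonempty (it contains 0) and bounded, so this sup is a genuine
   least upper bound. The unit ball, rather than the unit sphere, keeps the
   set nonempty for matrices without columns. *)
Definition opnorm2 p q (M : 'M[R]_(p, q)) : R :=
  sup [set norm2 (M *m v) | v in [set v : 'cV[R]_q | norm2 v <= 1]]%classic.

Definition fourier_mass n w (B : obp n w) (k : nat) : R :=
  \sum_(s : n.-tuple bool | count_mem true s == k) opnorm2 (obp_fourier B s).

End Matrices.

(* Main.v *)
(** The Fourier matrix of [B] at [s] is the product of the layer Fourier matrices,
so splitting [s] at its last 1 bounds level [j + 1] by level [j] times
[last_one_mass], the sum over all positions [i] of the norm of the difference
term of layer [i] followed by the averages of the later layers.  To bound the
latter uniformly, follow backwards through the program the potential
[row_spread Q], the sum over columns [v] and pairs of rows [x], [y] of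
[|Q x v - Q y v|].  Averaging over a regular layer decreases it by at least the
Frobenius norm of the corresponding difference term; at a non-regular
layer it is reset to at most [2 w ^ 2], since rows have l1 norm at most 1.  All
estimates use the Frobenius norm, which is submultiplicative, dominates the
operator norm, and is at most [sqrt w] on matrices with such rows. *)

Require Import Defs.
From HB Require Import structures.
From mathcomp Require Import all_boot all_order all_algebra.
From mathcomp Require Import classical_sets reals exp.
From mathcomp Require Import ring lra.

Set Implicit Arguments.
Unset Strict Implicit.
Unset Printing Implicit Defensive.

Import Order.TTheory GRing.Theory Num.Theory.
Local Open Scope ring_scope.

(** * Frobenius norms, row-contracting matrices and row spread *)

Lemma ler_sqr_sum_sum_sqr (R : realDomainType) (I : finType) (a : I -> R) :
  \sum_i a i ^+ 2 <= (\sum_i `|a i|) ^+ 2.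
Proof.
rewrite [leRHS]expr2 mulr_suml ler_sum // => i _.
rewrite (bigD1 i) //= mulrDr -expr2 real_normK ?num_real // lerDl.
by rewrite mulr_ge0 // sumr_ge0.
Qed.

(** Lagrange's identity: the sum of all [(a i * b j - a j * b i) ^+ 2] is twice the gap between the
    two sides. *)
Lemma cauchy_schwarz_sum (R : realFieldType) (I : finType) (a b : I -> R) :
  (\sum_i a i * b i) ^+ 2 <= (\sum_i a i ^+ 2) * (\sum_i b i ^+ 2).
Proof.
have : 0 <= \sum_i \sum_j (a i * b j - a j * b i) ^+ 2.
  by do 2!(apply: sumr_ge0 => ? _); exact: sqr_ge0.
have -> : \sum_i \sum_j (a i * b j - a j * b i) ^+ 2 =
    2 * ((\sum_i a i ^+ 2) * (\sum_i b i ^+ 2)) - 2 * (\sum_i a i * b i) ^+ 2.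
  have E1 : (\sum_i a i ^+ 2) * (\sum_i b i ^+ 2) =
      \sum_i \sum_j a i ^+ 2 * b j ^+ 2.
    by rewrite mulr_suml; apply: eq_bigr => i _; rewrite mulr_sumr.
  have E2 : (\sum_i a i * b i) ^+ 2 = \sum_i \sum_j (a i * b i) * (a j * b j).
    by rewrite expr2 mulr_suml; apply: eq_bigr => i _; rewrite mulr_sumr.
  have E3 : (\sum_i a i ^+ 2) * (\sum_i b i ^+ 2) =
      \sum_i \sum_j a j ^+ 2 * b i ^+ 2 by rewrite E1 exchange_big.
  rewrite [2 * _]mulr_natl mulr2n {1}E1 E3 E2 mulr_sumr -big_split -sumrB /=.
  apply: eq_bigr => i _; rewrite mulr_sumr -big_split -sumrB /=.
  by apply: eq_bigr => j _; ring.
lra.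
Qed.

Section Frobenius.
Variable R : realType.

Definition frob p q (M : 'M[R]_(p, q)) : R :=
  Num.sqrt (\sum_i \sum_j M i j ^+ 2).

Lemma sum_sqr_ge0 p q (M : 'M[R]_(p, q)) : 0 <= \sum_i \sum_j M i j ^+ 2.
Proof. by do 2!(apply: sumr_ge0 => ? _); exact: sqr_ge0. Qed.

Lemma frob_ge0 p q (M : 'M[R]_(p, q)) : 0 <= frob M.
Proof. exact: sqrtr_ge0. Qed.

Lemma frob_mulmx p q r (A : 'M[R]_(p, q)) (B : 'M[R]_(q, r)) :
  frob (A *m B) <= frob A * frob B.
Proof.
rewrite /frob -sqrtrM ?sum_sqr_ge0 // ler_sqrt ?mulr_ge0 ?sum_sqr_ge0 //.
rewrite mulr_suml ler_sum // => i _; rewrite [X in _ * X]exchange_big mulr_sumr.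
by apply: ler_sum => j _; rewrite mxE; exact: cauchy_schwarz_sum.
Qed.

(** The Euclidean norm of a column is its Frobenius norm, so submultiplicativity applies. *)
Lemma opnorm2_le_frob p q (M : 'M[R]_(p, q)) : opnorm2 M <= frob M.
Proof.
have norm2E r (v : 'cV[R]_r) : norm2 v = frob v.
  by congr Num.sqrt; apply: eq_bigr => i _; rewrite big_ord1.
apply: ge_sup => [|_ [v /= v1 <-]].
  exists (norm2 (M *m 0)), 0 => //=.
  rewrite /norm2 big1 ?sqrtr0 // => i _; by rewrite mxE expr0n.
rewrite norm2E (le_trans (frob_mulmx _ _)) // ler_piMr ?frob_ge0 //.
by rewrite -norm2E.
Qed.

Lemma frob_le_sum p q (M : 'M[R]_(p, q)) : frob M <= \sum_i \sum_j `|M i j|.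
Proof.
have h : 0 <= \sum_i \sum_j `|M i j| by do 2!(apply: sumr_ge0 => ? _).
rewrite -(ger0_norm h) -sqrtr_sqr ler_sqrt ?sqr_ge0 //.
apply: (@le_trans _ _ (\sum_i (\sum_j `|M i j|) ^+ 2)).
  by apply: ler_sum => i _; exact: ler_sqr_sum_sum_sqr.
rewrite (le_trans (ler_sqr_sum_sum_sqr _)) // le_eqVlt; apply/orP; left.
by apply/eqP; congr (_ ^+ 2); apply: eq_bigr => i _; rewrite ger0_norm ?sumr_ge0.
Qed.

(** Equivalently, the operator norm induced by the sup norm is at most 1. Signed entries are
    allowed, so half-differences of transition matrices qualify as well as averages. *)
Definition row_contracting p q (M : 'M[R]_(p, q)) : Prop :=
  forall i, \sum_j `|M i j| <= 1.

Lemma row_contracting_mulmx p q r (A : 'M[R]_(p, q)) (B : 'M[R]_(q, r)) :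
  row_contracting A -> row_contracting B -> row_contracting (A *m B).
Proof.
move=> hA hB i; apply: le_trans (hA i).
apply: (@le_trans _ _ (\sum_j \sum_k `|A i k| * `|B k j|)).
  apply: ler_sum => j _; rewrite mxE (le_trans (ler_norm_sum _ _ _)) //.
  by apply: ler_sum => k _; rewrite normrM.
rewrite exchange_big; apply: ler_sum => k _.
by rewrite -mulr_sumr ler_piMr.
Qed.

Lemma row_contracting1 p : row_contracting (1%:M : 'M[R]_p).
Proof.
move=> i; rewrite (bigD1 i) //= big1 ?addr0 => [|j /negPf ij].
  by rewrite mxE eqxx normr1.
by rewrite mxE eq_sym ij normr0.
Qed.

Lemma frob_row_contracting p q (M : 'M[R]_(p, q)) :
  row_contracting M -> frob M <= Num.sqrt p%:R.
Proof.
move=> hM; rewrite ler_sqrt ?ler0n //.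
apply: (@le_trans _ _ (\sum_(i < p) 1)); last by rewrite sumr_const card_ord.
apply: ler_sum => i _; rewrite (le_trans (ler_sqr_sum_sum_sqr _)) //.
by rewrite expr_le1 // sumr_ge0.
Qed.

Definition row_spread p q (M : 'M[R]_(p, q)) : R :=
  \sum_v \sum_x \sum_y `|M x v - M y v|.

Lemma row_spread_ge0 p q (M : 'M[R]_(p, q)) : 0 <= row_spread M.
Proof. by do 3!(apply: sumr_ge0 => ? _). Qed.

Lemma row_spread_le p q (M : 'M[R]_(p, q)) :
  row_contracting M -> row_spread M <= 2 * p%:R ^+ 2.
Proof.
move=> hM; rewrite /row_spread exchange_big /=.
apply: (@le_trans _ _ (\sum_(x < p) \sum_(y < p) 2)); last first.
  by rewrite !sumr_const !card_ord -mulrnA -[leLHS]mulr_natr natrM expr2.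
apply: ler_sum => x _; rewrite exchange_big; apply: ler_sum => y _ /=.
apply: (@le_trans _ _ (\sum_j `|M x j| + \sum_j `|M y j|)).
  by rewrite -big_split; apply: ler_sum => j _; exact: ler_normB.
by have := hM x; have := hM y; lra.
Qed.

End Frobenius.

(** * Sums over tuples *)

Lemma big_tuple0 (V : nmodType) (T : finType) (P : pred (seq T))
    (F : seq T -> V) :
  \sum_(x : 0.-tuple T | P x) F x = if P [::] then F [::] else 0.
Proof.
rewrite big_mkcond (bigD1 [tuple]) //= big1 ?addr0 // => x.
by rewrite tuple0.
Qed.

(** [P] and [F] take plain sequences, so [rcons x b] needs no cast between tuple types. *)
Lemma big_tuple_rcons (V : nmodType) (T : finType) m (P : pred (seq T))
    (F : seq T -> V) :
  \sum_(x : m.+1.-tuple T | P x) F x =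
  \sum_(b : T) \sum_(x : m.-tuple T | P (rcons x b)) F (rcons x b).
Proof.
pose h (p : T * m.-tuple T) := [tuple of rcons p.2 p.1].
have hinj : injective h.
  move=> [b x] [c y] /(congr1 val) /= /rcons_inj[xy ->].
  by congr pair; exact: val_inj.
have hbij : bijective h.
  by apply: inj_card_bij => //; rewrite card_prod !card_tuple expnS.
by rewrite (reindex h) /=; [rewrite pair_big_dep | exact: onW_bij].
Qed.

(** * Averages and differences over a single layer *)

Section Program.
Variables (R : realType) (n w : nat) (B : obp n w).

Definition layer_fourier i (s : bool)
    : 'M[R]_(obp_size B i, obp_size B i.+1) :=
  2^-1 *: \sum_(b : bool) (-1) ^+ (s && b) *: layer_mx R B i b.

Lemma layer_mx_mulmx i b q (Q : 'M[R]_(obp_size B i.+1, q)) u v :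
  (layer_mx R B i b *m Q) u v = Q (@obp_step n w B i u b) v.
Proof.
rewrite mxE (bigD1 (@obp_step n w B i u b)) //= mxE eqxx mul1r big1 ?addr0 //.
by move=> y /negPf yE; rewrite mxE eq_sym yE mul0r.
Qed.

Lemma layer_fourier_mulmx i s q (Q : 'M[R]_(obp_size B i.+1, q)) u v :
  (layer_fourier i s *m Q) u v =
  2^-1 * (Q (@obp_step n w B i u false) v
          + (-1) ^+ s * Q (@obp_step n w B i u true) v).
Proof.
rewrite /layer_fourier -scalemxAl big_bool /= andbT andbF expr0 scale1r.
rewrite mulmxDl -scalemxAl mxE [in LHS]mxE [in X in _ * (X + _)]mxE.
by rewrite !layer_mx_mulmx addrC.
Qed.

(** Each row is half the sum or half the difference of two standard basis vectors. *)
Lemma row_contracting_layer_fourier i s : row_contracting (layer_fourier i s).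
Proof.
move=> u; rewrite -[layer_fourier i s]mulmx1.
under eq_bigr do rewrite layer_fourier_mulmx normrM.
rewrite -mulr_sumr ger0_norm ?invr_ge0 //.
set a := obp_step _ _; set b := obp_step _ _.
apply: (@le_trans _ _ (2^-1 * (\sum_j `|1%:M a j| + \sum_j `|1%:M b j|))).
  rewrite ler_wpM2l ?invr_ge0 // -big_split ler_sum // => j _ /=.
  by rewrite (le_trans (ler_normD _ _)) // normrM normrX normrN1 expr1n mul1r.
by have := @row_contracting1 R _ a; have := @row_contracting1 R _ b; lra.
Qed.

(** Double counting of edges: the columns of the average sum to 1, so every vertex of the next layer
    has in-degree 2. *)
Lemma regular_layer_sum i (f : 'I_(obp_size B i.+1) -> R) :
  regular_layer R B i ->
  \sum_u (f (@obp_step n w B i u false) + f (@obp_step n w B i u true)) =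
  2 * \sum_v f v.
Proof.
move=> /andP[_ /and3P[_ _ /forallP colsum]].
have col v : \sum_u (layer_mx R B i false u v + layer_mx R B i true u v) = 2.
  have /eqP := colsum v; rewrite /layer_avg big_bool /=.
  under eq_bigr do rewrite mxE mxE addrC.
  by rewrite -mulr_sumr => h; lra.
have fE b u : f (@obp_step n w B i u b) = \sum_v layer_mx R B i b u v * f v.
  rewrite (bigD1 (@obp_step n w B i u b)) //= mxE eqxx mul1r big1 ?addr0 //.
  by move=> y /negPf yE; rewrite mxE eq_sym yE mul0r.
under eq_bigr do rewrite !fE -big_split.
rewrite exchange_big mulr_sumr; apply: eq_bigr => v _ /=.
rewrite -[in RHS](col v) mulr_suml; apply: eq_bigr => u _.
by rewrite mulrDl.
Qed.

(* In a regular layer every vertex has exactly two incoming edges, so the spread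
   of [Q] is a quarter of the sum over pairs of outgoing edges; the triangle
   inequality bounds the pairs leaving two distinct vertices, and the two edges
   leaving a common vertex account for the difference term. *)
Lemma regular_layer_row_spread i q (Q : 'M[R]_(obp_size B i.+1, q)) :
  regular_layer R B i ->
  row_spread (layer_fourier i false *m Q) + frob (layer_fourier i true *m Q)
    <= row_spread Q.
Proof.
(* Passing from the Frobenius norm to the entrywise l1 norm makes the claim a sum over columns, to
   be proved for each [v] separately. *)
move=> reg; apply: le_trans (lerD (lexx _) (frob_le_sum _)) _.
rewrite exchange_big /row_spread -big_split ler_sum // => v _ /=.
pose a u := Q (@obp_step n w B i u false) v.
pose b u := Q (@obp_step n w B i u true) v.
have -> : \sum_x \sum_y `|Q x v - Q y v| = 4^-1 * \sum_x \sum_y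
    ((`|a x - a y| + `|a x - b y|) + (`|b x - a y| + `|b x - b y|)).
  under [in RHS]eq_bigr => x _.
    rewrite big_split /= (regular_layer_sum (fun y => `|a x - Q y v|)) //.
    rewrite (regular_layer_sum (fun y => `|b x - Q y v|)) // -mulrDr.
    over.
  rewrite -mulr_sumr (regular_layer_sum (fun z => \sum_y `|Q z v - Q y v|)) //.
  by rewrite !mulrA; lra.
have avgE y : (layer_fourier i false *m Q) y v = 2^-1 * (a y + b y).
  by rewrite layer_fourier_mulmx expr0 mul1r.
have diffE y : `|(layer_fourier i true *m Q) y v| = 2^-1 * `|a y - b y|.
  by rewrite layer_fourier_mulmx expr1 mulN1r normrM ger0_norm ?invr_ge0.
rewrite mulr_sumr -big_split ler_sum // => x _ /=.
(* On the diagonal [y = x] the averages cancel, and the right side, [4^-1] times two copies of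
   [|a x - b x|], is exactly the difference entry. *)
rewrite mulr_sumr [leRHS](bigD1 x) //= (bigD1 x) //=.
rewrite subrr normr0 add0r addrC lerD //.
  by rewrite diffE !subrr normr0 addr0 add0r [`|b x - _|]distrC; lra.
apply: ler_sum => y _; rewrite !avgE.
have -> : 2^-1 * (a x + b x) - 2^-1 * (a y + b y) =
  4^-1 * (((a x - a y) + (a x - b y)) + ((b x - a y) + (b x - b y))) by lra.
rewrite normrM ger0_norm ?invr_ge0 // ler_wpM2l ?invr_ge0 //.
by rewrite (le_trans (ler_normD _ _)) // lerD // ler_normD.
Qed.

(** * Fourier coefficients as products over the layers *)

Fixpoint fourier_prefix (s : seq bool) m : 'M[R]_(obp_size B 0, obp_size B m) :=
  match m with
  | 0 => 1%:M
  | i.+1 => fourier_prefix s i *m layer_fourier i (nth false s i)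
  end.

Lemma fourier_prefix_eq s t m :
  (forall i, (i < m)%N -> nth false s i = nth false t i) ->
  fourier_prefix s m = fourier_prefix t m.
Proof.
elim: m => //= m IH st; rewrite IH ?st // => i im; exact/st/ltnW.
Qed.

Lemma obp_run_eq x y u m :
  (forall i, (i < m)%N -> nth false x i = nth false y i) ->
  @obp_run n w B x u m = @obp_run n w B y u m.
Proof.
elim: m => //= m IH st; rewrite IH ?st // => i im; exact/st/ltnW.
Qed.

Definition run_mx (x : seq bool) m : 'M[R]_(obp_size B 0, obp_size B m) :=
  \matrix_(u, v) (obp_run x u m == v)%:R.

Lemma run_mx_rcons x b :
  run_mx (rcons x b) (size x).+1 = run_mx x (size x) *m layer_mx R B (size x) b.
Proof.
apply/matrixP => u v; rewrite !mxE /= nth_rcons ltnn eqxx.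
rewrite (@obp_run_eq _ x) => [|i im]; last by rewrite nth_rcons im.
rewrite (bigD1 (obp_run x u (size x))) //= !mxE eqxx mul1r big1 ?addr0 //.
by move=> y /negPf yE; rewrite mxE eq_sym yE mul0r.
Qed.

(** Characters and run matrices are both multiplicative, so the uniform average over bit strings
    factors; the induction splits off the last bit. *)
Lemma fourier_prefixE s m :
  fourier_prefix s m = (2 ^+ m)^-1 *: \sum_(x : m.-tuple bool)
    (-1) ^+ (\sum_(i < m) (nth false s i && nth false x i))%N *: run_mx x m.
Proof.
elim: m => [|m IH] /=.
  rewrite (big_tuple0 predT (fun x => (-1) ^+ (\sum_(i < 0)
    (nth false s i && nth false x i))%N *: run_mx x 0)) /=.
  rewrite expr0 invr1 scale1r big_ord0 expr0 scale1r.
  by apply/matrixP => u v; rewrite !mxE.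
rewrite (big_tuple_rcons _ predT (fun x => (-1) ^+ (\sum_(i < m.+1)
  (nth false s i && nth false x i))%N *: run_mx x m.+1)) /=.
rewrite {}IH -scalemxAl -scalemxAr scalerA -invfM -exprSr; congr (_ *: _).
rewrite mulmx_sumr; apply: eq_bigr => b _.
rewrite mulmx_suml; apply: eq_bigr => x _.
rewrite -scalemxAl -scalemxAr scalerA -exprD.
have := run_mx_rcons x b; rewrite size_tuple => ->.
congr (_ ^+ _ *: _); rewrite big_ord_recr /= nth_rcons size_tuple ltnn eqxx.
congr addn; apply: eq_bigr => i _.
by rewrite nth_rcons size_tuple ltn_ord.
Qed.

Lemma obp_fourierE (s : n.-tuple bool) : obp_fourier R B s = fourier_prefix s n.
Proof.
rewrite fourier_prefixE; congr (_ *: _); apply: eq_bigr => x _.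
congr (_ ^+ _ *: _); rewrite big_mkcond; apply: eq_bigr => i _.
by rewrite !(tnth_nth false); case: nth.
Qed.

(** * Fourier mass by level, and the last 1 *)

Definition level_mass m j q (Q : 'M[R]_(obp_size B m, q)) : R :=
  \sum_(s : m.-tuple bool | count_mem true s == j)
    frob (fourier_prefix s m *m Q).

Fixpoint last_one_mass m q : 'M[R]_(obp_size B m, q) -> R :=
  match m with
  | 0 => fun=> 0
  | i.+1 => fun Q => last_one_mass (layer_fourier i false *m Q)
                     + frob (layer_fourier i true *m Q)
  end.

(** [Q] plays the part of everything after layer [m]: fixing the last bit of [s] moves its layer
    factor into [Q], and a 1 there lowers the remaining weight by one. *)
Lemma level_massS m j q (Q : 'M[R]_(obp_size B m.+1, q)) :
  level_mass j Q = level_mass j (layer_fourier m false *m Q)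
    + (if j is j'.+1 then level_mass j' (layer_fourier m true *m Q) else 0).
Proof.
rewrite /level_mass (big_tuple_rcons _ (fun s => count_mem true s == j)
  (fun s => frob (fourier_prefix s m.+1 *m Q))) big_bool /= addrC.
have prefix_rcons (x : m.-tuple bool) b :
    fourier_prefix (rcons x b) m *m layer_fourier m (nth false (rcons x b) m) *m Q
    = fourier_prefix x m *m (layer_fourier m b *m Q).
  rewrite nth_rcons size_tuple ltnn eqxx mulmxA; congr (_ *m _ *m _).
  by apply: fourier_prefix_eq => i im; rewrite nth_rcons size_tuple im.
have count_rcons (x : m.-tuple bool) b :
    count_mem true (rcons x b) = (count_mem true x + b)%N.
  by rewrite -cats1 count_cat /= addn0; case: b.
congr (_ + _).
  by apply: eq_big => [x|x _]; rewrite ?count_rcons ?addn0 ?prefix_rcons.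
case: j => [|j]; first by rewrite big_pred0 // => x; rewrite count_rcons addn1.
by apply: eq_big => [x|x _]; rewrite ?count_rcons ?addn1 ?eqSS ?prefix_rcons.
Qed.

Lemma level_mass_mulmx m j q (Q : 'M[R]_(obp_size B m, q)) :
  level_mass j Q <= level_mass j (1%:M : 'M[R]_(obp_size B m)) * frob Q.
Proof.
rewrite mulr_suml ler_sum // => s _.
by rewrite mulmx1; exact: frob_mulmx.
Qed.

(** The induction peels off trailing zeros of [s]. Once the last 1 is at position [i],
    submultiplicativity separates the prefix of length [i], with [j] ones, from a term of
    [last_one_mass]; hence [C] must serve all [i < m]. *)
Lemma level_massS_le C m j q (Q : 'M[R]_(obp_size B m, q)) :
  (forall i, (i < m)%N -> level_mass j (1%:M : 'M[R]_(obp_size B i)) <= C) ->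
  level_mass j.+1 Q <= C * last_one_mass Q.
Proof.
elim: m Q => [|m IH] Q hC.
  by rewrite mulr0 /level_mass big_pred0 // => s; rewrite tuple0.
rewrite level_massS /= mulrDr lerD //.
  by apply: IH => i im; apply: hC; exact: ltnW.
by rewrite (le_trans (level_mass_mulmx _ _)) // ler_wpM2r ?frob_ge0 // hC.
Qed.

Lemma frob_row_contracting_le m q (Q : 'M[R]_(obp_size B m, q)) :
  (m <= n)%N -> row_contracting Q -> frob Q <= Num.sqrt w%:R.
Proof.
move=> mn hQ; rewrite (le_trans (frob_row_contracting hQ)) //.
by rewrite ler_sqrt ?ler0n // ler_nat; exact: obp_size_le.
Qed.

(** Only the zero string contributes, with a product of averages and [Q], which is
    row-contracting. *)
Lemma level_mass0_le m q (Q : 'M[R]_(obp_size B m, q)) :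
  (m <= n)%N -> row_contracting Q -> level_mass 0 Q <= Num.sqrt w%:R.
Proof.
elim: m Q => [|m IH] Q mn hQ.
  rewrite /level_mass (big_tuple0 (fun s => count_mem true s == 0)
    (fun s => frob (fourier_prefix s 0 *m Q))) /=.
  by rewrite mul1mx; exact: frob_row_contracting_le.
rewrite level_massS addr0 IH 1?ltnW //.
by apply: row_contracting_mulmx => //; exact: row_contracting_layer_fourier.
Qed.

(** A regular layer pays for its difference term by the drop in spread. Each non-regular layer is
    charged [2 * w ^ 2] for the new spread and [sqrt w] for its difference term. *)
Lemma last_one_mass_le m q (Q : 'M[R]_(obp_size B m, q)) :
  (m <= n)%N -> row_contracting Q ->
  last_one_mass Q <= row_spread Q
    + (2 * w%:R ^+ 2 + Num.sqrt w%:R)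
      * (\sum_(i < m) ~~ regular_layer R B i)%N%:R.
Proof.
elim: m Q => [|m IH] Q mn hQ /=.
  by rewrite big_ord0 mulr0 addr0 row_spread_ge0.
have avgC := row_contracting_mulmx (@row_contracting_layer_fourier m false) hQ.
have diffC := row_contracting_mulmx (@row_contracting_layer_fourier m true) hQ.
have {IH} := IH _ (ltnW mn) avgC.
have frob_diff := frob_row_contracting_le (ltnW mn) diffC.
have spread_avg : row_spread (layer_fourier m false *m Q) <= 2 * w%:R ^+ 2.
  rewrite (le_trans (row_spread_le avgC)) // ler_wpM2l // lerXn2r ?nnegrE //.
  by rewrite ler_nat obp_size_le // ltnW.
(* Needed at a non-regular layer, where the old spread is discarded. *)
have := row_spread_ge0 Q.
rewrite big_ord_recr /=; case: (boolP (regular_layer R B m)) => [reg|_] /=.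
  by rewrite addn0; have := regular_layer_row_spread Q reg; lra.
by rewrite addn1 -natr1; lra.
Qed.

(** The initial spread, at most [2 * w ^ 2], costs no more than one further non-regular layer,
    whence [k + 1]. *)
Lemma last_one_mass1_le m k : (m <= n)%N -> (#|nonregular_layers R B| <= k)%N ->
  last_one_mass (1%:M : 'M[R]_(obp_size B m)) <=
    (2 * w%:R ^+ 2 + 1) * Num.sqrt w%:R * (k%:R + 1).
Proof.
move=> mn hB.
have := last_one_mass_le mn (@row_contracting1 R _).
have : row_spread (1%:M : 'M[R]_(obp_size B m)) <= 2 * w%:R ^+ 2.
  rewrite (le_trans (row_spread_le (@row_contracting1 R _))) //.
  by rewrite ler_wpM2l // lerXn2r ?nnegrE // ler_nat obp_size_le.
set N := (\sum_(i < m) _)%N => spread.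
have Nk : (N <= k)%N.
  apply: leq_trans hB; rewrite -sum1_card big_mkcond /=.
  have -> : (\sum_(i < n) (if i \in nonregular_layers R B then 1 else 0) =
      \sum_(i < n) ~~ regular_layer R B i)%N.
    by apply: eq_bigr => i _; rewrite inE; case: ifP.
  rewrite /N -!(big_mkord xpredT (fun i => nat_of_bool (~~ regular_layer R B i))).
  by rewrite [leqRHS](@big_cat_nat _ _ _ m) //= leq_addr.
move=> bound; apply: le_trans bound _.
have : 2 * w%:R ^+ 2 + Num.sqrt w%:R <= (2 * w%:R ^+ 2 + 1) * Num.sqrt w%:R :> R.
  (* Both sides vanish at [w = 0]; otherwise [sqrt w >= 1]. *)
  have [->|w_gt0] := posnP w; first by rewrite sqrtr0 expr0n !mulr0 addr0.
  have sqrt_ge1 : 1 <= Num.sqrt w%:R :> R.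
    by rewrite -[leLHS]sqrtr1 ler_sqrt ?ler0n // ler1n.
  have : w%:R ^+ 2 <= w%:R ^+ 2 * Num.sqrt w%:R :> R.
    by rewrite ler_peMr ?exprn_ge0.
  lra.
set S := 2 * _ + _; set K := _ * Num.sqrt _ => SK.
have S_spread : 2 * w%:R ^+ 2 <= S :> R by rewrite lerDl sqrtr_ge0.
have S_ge0 : 0 <= S by apply: le_trans S_spread; rewrite mulr_ge0 ?exprn_ge0.
have NkR : N%:R <= k%:R :> R by rewrite ler_nat.
rewrite mulrDr mulr1 addrC lerD //; last exact: le_trans (le_trans spread _) SK.
by rewrite ler_pM.
Qed.

(** Induction on [j] for all [m] at once, since the step uses level [j] at every shorter length;
    each further 1 costs one factor [last_one_mass]. *)
Lemma level_mass1_le m j k : (m <= n)%N -> (#|nonregular_layers R B| <= k)%N ->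
  level_mass j (1%:M : 'M[R]_(obp_size B m)) <=
    Num.sqrt w%:R * ((2 * w%:R ^+ 2 + 1) * Num.sqrt w%:R * (k%:R + 1)) ^+ j.
Proof.
move=> + hB; elim: j m => [|j IH] m mn.
  by rewrite mulr1 level_mass0_le //; exact: row_contracting1.
rewrite exprSr mulrA.
have hC i (im : (i < m)%N) := IH i (ltnW (leq_trans im mn)).
apply: le_trans (level_massS_le _ hC) _.
rewrite ler_wpM2l ?last_one_mass1_le //.
rewrite mulr_ge0 ?sqrtr_ge0 // exprn_ge0 //.
by rewrite !mulr_ge0 ?sqrtr_ge0 ?addr_ge0 ?mulr_ge0 ?exprn_ge0.
Qed.

End Program.

(** * The two bounds on the operator-norm mass *)

Theorem theorem3p10 (R : realType) (n w k : nat) (B : obp n w)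
    (hB : (#|nonregular_layers R B| <= k)%N)
    (k' : nat) (hk' : (1 <= k' <= n)%N) :
  fourier_mass R B k'
    <= Num.sqrt (w%:R : R)
       * ((2 * w%:R ^+ 2 + 1) * Num.sqrt w%:R * (k%:R + 1)) ^+ k'
    <= Num.sqrt (w%:R : R) * (3 * (w%:R `^ (5 / 2)) * (k%:R + 1)) ^+ k'.
Proof.
apply/andP; split.
  apply: le_trans (level_mass1_le k' (leqnn n) hB).
  apply: ler_sum => s _; rewrite mulmx1 obp_fourierE.
  exact: opnorm2_le_frob.
have powE : w%:R `^ (5 / 2) = w%:R ^+ 2 * Num.sqrt w%:R :> R.
  have -> : 5 / 2 = 2%:R + 2^-1 :> R by lra.
  (* The exponents do not sum to 0, so the power splits even for [w = 0]. *)
  rewrite powRD; last by apply/implyP => /eqP; lra.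
  by rewrite powR_mulrn // powR12_sqrt.
have base_ge0 : 0 <= (2 * w%:R ^+ 2 + 1) * Num.sqrt w%:R * (k%:R + 1) :> R.
  by rewrite !mulr_ge0 ?sqrtr_ge0 ?addr_ge0 ?mulr_ge0 ?exprn_ge0.
have base_le : (2 * w%:R ^+ 2 + 1) * Num.sqrt w%:R * (k%:R + 1)
    <= 3 * (w%:R `^ (5 / 2)) * (k%:R + 1) :> R.
  rewrite powE [3 * _]mulrA ler_wpM2r ?addr_ge0 //.
  (* Both sides vanish at [w = 0]; otherwise [1 <= w ^ 2] gives [2 * w ^ 2 + 1 <= 3 * w ^ 2]. *)
  case: w {B hB powE base_ge0} => [|w']; first by rewrite sqrtr0 !mulr0.
  rewrite ler_wpM2r ?sqrtr_ge0 //.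
  have : 1 <= w'.+1%:R ^+ 2 :> R by rewrite exprn_ege1 // ler1n.
  lra.
rewrite ler_wpM2l ?sqrtr_ge0 // lerXn2r ?nnegrE //.
exact: le_trans base_le.
Qed.
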